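(* Let $X=(X,\|\cdot\|)$ be a real normed linear space and let $0<r\leq 1$. Then $X$ is an inner product space if and only if the inequality $$\alpha[x,y]\leq\left(\frac{1+c^{r}[x,y]}{2}\right)^{\frac{1}{r}}\frac{\|x-y\|+\big|\|x\|-\|y\|\big|}{\max\{\|x\|,\|y\|\}}$$ holds for all nonzero vectors $x,y\in X$ with $x\neq y$, where $$c[x,y]=\frac{\max\{\|x\|,\|y\|\}}{\min\{\|x\|,\|y\|\}}\cdot\frac{\|x-y\|-\big|\|x\|-\|y\|\big|}{\|x-y\|+\big|\|x\|-\|y\|\big|}$$ and $c^{r}[x,y]=(c[x,y])^{r}$.
   Context: For nonzero vectors $x,y\in X$, the angular distance is $\alpha[x,y]=\left\|\frac{x}{\|x\|}-\frac{y}{\|y\|}\right\|$. A normed linear space is called an inner product space if its norm is induced by an inner product. *)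

(* Defs.v *)
From mathcomp Require Import all_boot all_order all_algebra.
From mathcomp Require Import reals normedtype exp.

Set Implicit Arguments.
Unset Strict Implicit.
Unset Printing Implicit Defensive.

Import Order.TTheory GRing.Theory Num.Theory.
Import numFieldNormedType.Exports.
Local Open Scope ring_scope.

(* The norm of X is induced by an inner product; over a real field the inner
   products on X are the positive definite forms of [{dot X for idfun}]. *)
Definition inner_product_space (R : realType) (X : normedModType R) : Prop :=
  exists f : {dot X for idfun}, forall x : X, `|x| = Num.sqrt (f x x).

Section AngularDistance.
Variables (R : realType) (X : normedModType R).
Implicit Types x y : X.

Definition angular_distance x y : R :=
  `| `|x|^-1 *: x - `|y|^-1 *: y |.

(* For nonzero x != y both denominators below are positive. *)
Definition cfactor x y : R :=
  (Num.max `|x| `|y| / Num.min `|x| `|y|) *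
  ((`|x - y| - `| `|x| - `|y| |) / (`|x - y| + `| `|x| - `|y| |)).

End AngularDistance.

(* Main.v *)
Require Import Defs.
From HB Require Import structures.
From mathcomp Require Import all_boot all_order all_algebra.
From mathcomp Require Import ring lra.
From mathcomp Require Import reals normedtype exp.
From mathcomp Require Import unstable classical_sets interval_inference convex.
From mathcomp Require Import hoelder topology.

(** Write a, b for the norms of x, y and d for that of x - y.  The right-hand
    side of the inequality is the power mean of exponent r of 1 and c, times
    k = (d + |a - b|) / max a b, and c is built so that two other means become
    simple: the geometric one gives
    [sqrt c * k = sqrt ((d ^ 2 - (a - b) ^ 2) / (a b))] ([geometric_bound]),
    the arithmetic one gives
    [(1 + c) / 2 * k = (d (a + b) - (a - b) ^ 2) / (2 a b)]
    ([arithmetic_bound]).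

    In an inner product space the angular distance is exactly the geometric
    expression ([angular_distance_inner]), and a power mean of positive
    exponent dominates the geometric mean.

    Conversely, as r <= 1, the arithmetic expression bounds the angular
    distance.  Apply this to (1 + e)(p + q) and (1 - e)(q - p), where p + q and
    p - q have the same norm L (p and q are isosceles orthogonal): it becomes
    [|p + e q| >= |p| + e ^ 2 (L - |p|)] ([angular_bound_gap]).  Hence p is a
    point of least norm on the line p + R q, and the only one if |p| < L.

    This makes isosceles orthogonality homogeneous.  The midpoint of a chord of
    a sphere is isosceles orthogonal to the direction q of the chord, hence of
    least norm on the line that carries it, and it is the only such point when
    it lies strictly inside the sphere.  As p has least norm on p + R q, it is
    the midpoint of every chord cut out of this line by a sphere of radius
    larger than |p|.  So p + t q and p - t q have the same norm for all t
    ([isosceles_homogeneous]).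

    Take two unit vectors u, v that are not collinear.  Then u + v and u - v are
    isosceles orthogonal, and once normalized they form a basis p, q of the
    plane for which every Euclidean reflection is an isometry, so that the norm
    is Euclidean there ([norm_orthonormal]).  So [|s x + t y| ^ 2] is a
    quadratic polynomial in s and t for all x and y ([plane_quadratic]).  It
    gives the parallelogram law, from which the polar form is additive, and the
    homogeneity of the polar form without any continuity argument
    ([jordan_von_neumann]). *)

Set Implicit Arguments.
Unset Strict Implicit.
Unset Printing Implicit Defensive.

Import Order.TTheory GRing.Theory Num.Theory.
Import numFieldNormedType.Exports.
Local Open Scope ring_scope.

(** * Power means of 1 and c *)

Section PowerMeans.
Variables (R : realType) (r : R).
Hypotheses (r_gt0 : 0 < r) (r_le1 : r <= 1).

(** Convexity of the power of exponent r^-1 >= 1, at 1 and c `^ r. *)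
Lemma power_mean_le_arithmetic (c : R) : 0 <= c ->
  ((1 + c `^ r) / 2) `^ r^-1 <= (1 + c) / 2.
Proof.
move=> c_ge0; set z := c `^ r.
have z_ge0 : 0 <= z by exact: powR_ge0.
have zrV : z `^ r^-1 = c by rewrite /z -powRrM mulfV ?gt_eqF// powRr1.
have rV_ge1 : 1 <= r^-1 by rewrite invf_ge1.
have half01 : 0 <= (2^-1 : R) <= 1 by lra.
have [h0 h1] := andP half01.
have := convex_powR rV_ge1 (Itv01 h0 h1) (x := 1) (y := z).
rewrite !inE /= !in_itv /= !andbT ler01 z_ge0 => /(_ isT isT).
rewrite [X in X `^ _ <= _ -> _]convRE convRE /= /unstable.onem powR1 zrV.
suff -> : 2^-1 * 1 + (1 - 2^-1) * z = (1 + z) / 2.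
  by move=> /le_trans; apply; lra.
by lra.
Qed.

(** The inequality of arithmetic and geometric means for 1 and c `^ r. *)
Lemma geometric_le_power_mean (c : R) : 0 <= c ->
  Num.sqrt c <= ((1 + c `^ r) / 2) `^ r^-1.
Proof.
move=> c_ge0; set z := c `^ (r / 2).
have zz : c `^ r = z ^+ 2.
  by rewrite -powR_mulrn ?powR_ge0// -powRrM divfK.
have -> : Num.sqrt c = z `^ r^-1.
  rewrite -powR12_sqrt// -powRrM; congr (_ `^ _).
  by rewrite mulrAC mulfV ?gt_eqF// mul1r.
have z_ge0 : 0 <= z by exact: powR_ge0.
apply: ge0_ler_powR; rewrite ?nnegrE//.
- by rewrite invr_ge0 ltW.
- by rewrite zz; have := sqr_ge0 z; lra.
- by rewrite zz; have := sqr_ge0 (z - 1); rewrite sqrrB1; lra.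
Qed.

End PowerMeans.

(** * The angular distance and the means of 1 and c *)

Section AngularBound.
Variables (R : realType) (X : normedModType R).
Implicit Types x y : X.

Lemma cfactor_ge0 x y : 0 <= cfactor x y.
Proof.
rewrite /cfactor !mulr_ge0// ?invr_ge0 ?le_max ?le_min ?normr_ge0//.
by rewrite subr_ge0 ler_dist_dist.
Qed.

Lemma dist_add_gt0 x y : x != y -> 0 < `|x - y| + `| `|x| - `|y| |.
Proof.
by move=> neq_xy; rewrite ltr_pwDl// normr_gt0 subr_eq0.
Qed.

(** With a >= b, say, c * k = (d - (a - b)) / b and k = (d + (a - b)) / a; their
    half-sum no longer depends on which of a, b is the larger. *)
Lemma arithmetic_bound x y : x != 0 -> y != 0 -> x != y ->
  (1 + cfactor x y) / 2 *
    ((`|x - y| + `| `|x| - `|y| |) / Num.max `|x| `|y|) =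
  (`|x - y| * (`|x| + `|y|) - (`|x| - `|y|) ^+ 2) / (2 * `|x| * `|y|).
Proof.
move=> x_neq0 y_neq0 /dist_add_gt0; rewrite /cfactor.
have : 0 < `|x| by rewrite normr_gt0.
have : 0 < `|y| by rewrite normr_gt0.
move: `|x - y| `|x| `|y| => d a b b_gt0 a_gt0.
have [le_ab|/ltW le_ba] := leP a b.
  rewrite ler0_norm ?subr_le0// => s_gt0.
  by field; rewrite ?gt_eqF//=; lra.
rewrite ger0_norm ?subr_ge0// => s_gt0.
by field; rewrite ?gt_eqF//=; lra.
Qed.

(** With a >= b, say, this is the product of k = (d + (a - b)) / a and
    c * k = (d - (a - b)) / b. *)
Lemma geometric_bound x y : x != 0 -> y != 0 -> x != y ->
  cfactor x y *
    ((`|x - y| + `| `|x| - `|y| |) / Num.max `|x| `|y|) ^+ 2 =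
  (`|x - y| ^+ 2 - (`|x| - `|y|) ^+ 2) / (`|x| * `|y|).
Proof.
move=> x_neq0 y_neq0 /dist_add_gt0; rewrite /cfactor.
have : 0 < `|x| by rewrite normr_gt0.
have : 0 < `|y| by rewrite normr_gt0.
move: `|x - y| `|x| `|y| => d a b b_gt0 a_gt0.
have [le_ab|/ltW le_ba] := leP a b.
  rewrite ler0_norm ?subr_le0// => s_gt0.
  by field; rewrite ?gt_eqF//=; lra.
rewrite ger0_norm ?subr_ge0// => s_gt0.
by field; rewrite ?gt_eqF//=; lra.
Qed.

Lemma angular_distance_inner x y : inner_product_space X ->
  x != 0 -> y != 0 ->
  angular_distance x y ^+ 2 =
  (`|x - y| ^+ 2 - (`|x| - `|y|) ^+ 2) / (`|x| * `|y|).
Proof.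
move=> [f normE] x_neq0 y_neq0.
have norm_sqr z : `|z| ^+ 2 = f z z.
  rewrite normE sqr_sqrtr//; have [->|z_neq0] := eqVneq z 0.
    by rewrite linear0l.
  exact/ltW/neq0_dnorm_gt0.
have fC u v : f u v = f v u by rewrite hermC expr0 mul1r.
have combE (a b : R) : `|a *: x - b *: y| ^+ 2 =
    a ^+ 2 * `|x| ^+ 2 + b ^+ 2 * `|y| ^+ 2 - 2 * a * b * f x y.
  rewrite !norm_sqr !(linearBl, linearBr) !(linearZl_LR, linearZr_LR) /=.
  by rewrite (fC y x) /=; ring.
have dE : `|x - y| ^+ 2 = `|x| ^+ 2 + `|y| ^+ 2 - 2 * f x y.
  by have := combE 1 1; rewrite !scale1r => ->; ring.
rewrite /angular_distance combE dE; field.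
by rewrite !normr_eq0 x_neq0 y_neq0.
Qed.

End AngularBound.

(** * Isosceles orthogonality and points of least norm *)

Section Orthogonality.
Variables (R : realType) (X : normedModType R).
Implicit Types p q x y u v : X.

Lemma lincombD p q (a b c d : R) :
  (a *: p + b *: q) + (c *: p + d *: q) = (a + c) *: p + (b + d) *: q.
Proof. by rewrite addrACA -!scalerDl. Qed.

Lemma lincombZ p q (k a b : R) :
  k *: (a *: p + b *: q) = (k * a) *: p + (k * b) *: q.
Proof. by rewrite scalerDr !scalerA. Qed.

Lemma lincombB p q (a b c d : R) :
  (a *: p + b *: q) - (c *: p + d *: q) = (a - c) *: p + (b - d) *: q.
Proof. by rewrite -scaleN1r lincombZ lincombD !mulN1r. Qed.

Lemma lincomb_add p q : p + q = 1 *: p + 1 *: q.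
Proof. by rewrite !scale1r. Qed.

Lemma lincomb_sub p q : p - q = 1 *: p + (- 1) *: q.
Proof. by rewrite scale1r scaleN1r. Qed.

Definition isosceles p q := `|p + q| = `|p - q|.

(** A quantitative form of the implication from isosceles to Birkhoff
    orthogonality.  The factor [`|p + q| - `|p|], the amount by which p lies
    inside the sphere through p + q and p - q, makes the minimum at p strict. *)
Definition isosceles_gap := forall p q (e : R), isosceles p q -> `|e| < 1 ->
  `|p| + e ^+ 2 * (`|p + q| - `|p|) <= `|p + e *: q|.

Lemma isosceles_le_diagonal p q : isosceles p q -> `|p| <= `|p + q|.
Proof.
move=> iso; have : `|(p + q) + (p - q)| <= `|p + q| + `|p - q| := ler_normD _ _.
rewrite -iso addrACA subrr addr0 -mulr2n -scaler_nat normrZ normr_nat; lra.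
Qed.

(** The vectors x = (1 + e)(p + q) and y = (1 - e)(q - p) have the directions of
    p + q and q - p, so their angular distance is 2 |p| / |p + q| whatever e is,
    while x - y = 2 (p + e q): the bound compares the norms of p and p + e q. *)
Lemma angular_bound_gap :
  (forall x y, x != 0 -> y != 0 -> x != y ->
    angular_distance x y <=
    (`|x - y| * (`|x| + `|y|) - (`|x| - `|y|) ^+ 2) / (2 * `|x| * `|y|)) ->
  isosceles_gap.
Proof.
move=> bound p q e iso; rewrite ltr_norml => /andP[e_gtN1 e_lt1].
have le_pl := isosceles_le_diagonal iso; set l := `|p + q| in le_pl *.
have [l0|l_neq0] := eqVneq l 0.
  have -> : `|p| = 0 by apply: le_anti; rewrite -{1}l0 le_pl normr_ge0.
  by rewrite l0 subrr mulr0 addr0.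
have [->|e_neq0] := eqVneq e 0.
  by rewrite expr0n mul0r addr0 scale0r addr0.
have l_gt0 : 0 < l by rewrite lt0r l_neq0 normr_ge0.
have le_gt0 : 0 < 1 + e by lra.
have ge_gt0 : 0 < 1 - e by lra.
pose x := (1 + e) *: (p + q); pose y := (1 - e) *: (q - p).
have norm_x : `|x| = (1 + e) * l by rewrite normrZ gtr0_norm.
have norm_y : `|y| = (1 - e) * l by rewrite normrZ gtr0_norm// distrC -iso.
have x_gt0 : 0 < `|x| by rewrite norm_x mulr_gt0.
have y_gt0 : 0 < `|y| by rewrite norm_y mulr_gt0.
have xBy : x - y = 2 *: (p + e *: q).
  have qBp : q - p = (- 1) *: p + 1 *: q by rewrite scale1r scaleN1r addrC.
  rewrite /x /y qBp lincomb_add !lincombZ lincombB -[p in RHS]scale1r lincombZ.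
  by congr (_ *: _ + _ *: _); ring.
have dist : `|x - y| = 2 * `|p + e *: q| by rewrite xBy normrZ normr_nat.
have ang : angular_distance x y = 2 * `|p| / l.
  rewrite /angular_distance norm_x norm_y !scalerA.
  have -> : ((1 + e) * l)^-1 * (1 + e) = l^-1 by field; rewrite ?gt_eqF.
  have -> : ((1 - e) * l)^-1 * (1 - e) = l^-1 by field; rewrite ?gt_eqF.
  rewrite -scalerBr opprB addrACA subrr addr0.
  by rewrite -mulr2n -scaler_nat !normrZ normfV normr_nat gtr0_norm// mulrC.
have neq_xy : x != y.
  apply/eqP => /(congr1 (fun z : X => `|z|)); rewrite norm_x norm_y.
  by move/(mulIf l_neq0) => ?; move/eqP: e_neq0; apply; lra.
have := bound x y; rewrite -!normr_gt0 x_gt0 y_gt0 neq_xy => /(_ isT isT isT).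
rewrite ang dist norm_x norm_y.
have -> : (2 * `|p + e *: q| * ((1 + e) * l + (1 - e) * l) -
   ((1 + e) * l - (1 - e) * l) ^+ 2) / (2 * ((1 + e) * l) * ((1 - e) * l)) =
   2 * ((`|p + e *: q| - e ^+ 2 * l) / (1 - e ^+ 2)) / l.
  by field; rewrite -?subr_sqr ?subr_eq0 ?gt_eqF//=; nra.
have d_gt0 : 0 < 1 - e ^+ 2 by nra.
rewrite ler_pM2r ?invr_gt0// ler_pM2l// ler_pdivlMr//; lra.
Qed.

Section Gap.
Hypothesis gap : isosceles_gap.

(** Convexity of the norm along a ray: it carries a lower bound from a
    neighbourhood of p to the whole ray. *)
Lemma ray_contraction p q (t th : R) : 0 <= th <= 1 ->
  `|p + (th * t) *: q| - `|p| <= th * (`|p + t *: q| - `|p|).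
Proof.
move=> /andP[th_ge0 th_le1].
have -> : p + (th * t) *: q = (1 - th) *: p + th *: (p + t *: q).
  by rewrite scalerBl scale1r scalerDr scalerA addrA subrK.
have := ler_normD ((1 - th) *: p) (th *: (p + t *: q)).
rewrite !normrZ !ger0_norm ?subr_ge0//; lra.
Qed.

Lemma contraction_factor (t : R) : exists2 th : R, 0 < th <= 1 & `|th * t| < 1.
Proof.
have d_gt0 : 0 < 1 + `|t| by rewrite ltr_wpDr.
exists (1 + `|t|)^-1.
  by rewrite invr_gt0 d_gt0 invf_le1// lerDl normr_ge0.
by rewrite normrM gtr0_norm ?invr_gt0// mulrC ltr_pdivrMr// mul1r ltrDr.
Qed.

Lemma isosceles_minimizer p q (t : R) : isosceles p q -> `|p| <= `|p + t *: q|.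
Proof.
move=> iso; have le_p := isosceles_le_diagonal iso.
have [th /andP[th_gt0 th_le1] small] := contraction_factor t.
have := gap iso small; have := sqr_ge0 (th * t).
have : 0 <= th <= 1 by rewrite ltW.
move=> /(ray_contraction p q t) contr sq gapt.
rewrite -subr_ge0 -(pmulr_rge0 _ th_gt0).
apply: le_trans contr; nra.
Qed.

Lemma isosceles_strict_minimizer p q (t : R) : isosceles p q ->
  `|p| < `|p + q| -> t != 0 -> `|p| < `|p + t *: q|.
Proof.
move=> iso lt_p t_neq0.
have [th /andP[th_gt0 th_le1] small] := contraction_factor t.
have := gap iso small.
have sq : 0 < (th * t) ^+ 2 by rewrite exprn_even_gt0// mulf_neq0// gt_eqF.
have : 0 <= th <= 1 by rewrite ltW.
move=> /(ray_contraction p q t) contr gapt.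
rewrite -subr_gt0 -(pmulr_rgt0 _ th_gt0).
apply: lt_le_trans contr; nra.
Qed.

(** The norm is continuous and unbounded on the ray. *)
Lemma level_on_ray p q (l : R) : q != 0 -> `|p| <= l ->
  exists2 t : R, 0 <= t & `|p + t *: q| = l.
Proof.
move=> q_neq0 le_pl; have q_gt0 : 0 < `|q| by rewrite normr_gt0.
pose b := (l + `|p|) / `|q|.
have b_ge0 : 0 <= b by rewrite divr_ge0// addr_ge0// (le_trans _ le_pl).
have le_lb : l <= `|p + b *: q|.
  have := lerB_normD (b *: q) p.
  by rewrite normrZ ger0_norm// divfK ?gt_eqF// addrK addrC.
have cont : {within `[0, b], continuous (fun t : R => `|p + t *: q|)}%classic.
  apply: continuous_subspaceT => t.
  apply: (@continuous_comp _ _ _ (fun t : R => p + t *: q) (fun x => `|x|));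
    last exact: norm_continuous.
  by apply: cvgD; [exact: cvg_cst|apply: cvgZr_tmp; exact: cvg_id].
have le_pb : `|p| <= `|p + b *: q| := le_trans le_pl le_lb.
have [] := IVT b_ge0 cont (v := l).
  by rewrite scale0r addr0 min_l// max_r// le_pl.
by move=> t /[!in_itv]/= /andP[t_ge0 _] <-; exists t.
Qed.

(** Otherwise the sphere of radius |p - t q| meets the line p + R q again at
    p + t' q with t' >= 0 and t' != t.  Then p and the midpoint m of this chord
    are two different points of least norm on the line, while m is the only
    one. *)
Lemma isosceles_scale_pos p q (t : R) : 0 < t -> isosceles p q ->
  `|p - t *: q| <= `|p + t *: q|.
Proof.
move=> t_gt0 iso; rewrite leNgt; apply/negP => lt_norm.
have [q0|q_neq0] := eqVneq q 0.
  by move: lt_norm; rewrite q0 scaler0 subr0 addr0 ltxx.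
set l := `|p - t *: q| in lt_norm.
have lt_pl : `|p| < l by apply: le_lt_trans lt_norm; exact: isosceles_minimizer.
have [t' t'_ge0 t'l] := level_on_ray q_neq0 (ltW lt_pl).
pose m := p + ((t' - t) / 2) *: q; pose h := ((t' + t) / 2) *: q.
have mDh : m + h = p + t' *: q.
  by rewrite /m /h -addrA -scalerDl; congr (_ + _ *: _); field.
have mBh : m - h = p - t *: q.
  rewrite /m /h -addrA -scalerBl.
  have -> : (t' - t) / 2 - (t' + t) / 2 = - t by field.
  by rewrite scaleNr.
have iso_mh : isosceles m h by rewrite /isosceles mDh mBh t'l.
have [tt'|neq_tt'] := eqVneq t' t.
  by move: lt_norm; rewrite -tt' t'l ltxx.
(* The position of p on the chord; it is not the midpoint since t' != t. *)
pose t0 := - ((t' - t) / (t' + t)).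
have t0_neq0 : t0 != 0.
  by rewrite oppr_eq0 mulf_neq0 ?subr_eq0 ?invr_eq0// gt_eqF//; lra.
have pE : m + t0 *: h = p.
  rewrite /m /h scalerA -addrA -scalerDl.
  have -> : (t' - t) / 2 + t0 * ((t' + t) / 2) = 0.
    by rewrite /t0; field; rewrite gt_eqF//; lra.
  by rewrite scale0r addr0.
have lt_mp : `|m| < `|p|.
  have le_mp : `|m| <= `|p|.
    by have := isosceles_minimizer t0 iso_mh; rewrite pE.
  have lt_mh : `|m| < `|m + h| by rewrite mDh t'l; exact: le_lt_trans lt_pl.
  by have := isosceles_strict_minimizer iso_mh lt_mh t0_neq0; rewrite pE.
have := isosceles_minimizer ((t' - t) / 2) iso.
by rewrite -/m leNgt lt_mp.
Qed.

Lemma isosceles_homogeneous p q (a b : R) : isosceles p q ->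
  isosceles (a *: p) (b *: q).
Proof.
have pos p' q' (t : R) : 0 < t -> isosceles p' q' -> isosceles p' (t *: q').
  move=> t_gt0 iso; apply: le_anti; rewrite isosceles_scale_pos// andbT.
  have isoN : isosceles p' (- q') by rewrite /isosceles opprK iso.
  by have := isosceles_scale_pos t_gt0 isoN; rewrite scalerN opprK.
have oppC p' q' : isosceles p' q' -> isosceles p' (- q').
  by rewrite /isosceles opprK => ->.
have sc p' q' (t : R) : isosceles p' q' -> isosceles p' (t *: q').
  move=> iso; have [t_lt0|t_gt0|->] := ltrgt0P t; last 1 first.
  - by rewrite /isosceles scale0r addr0 subr0.
  - exact: pos.
  - by rewrite -[t]opprK scaleNr; apply/oppC/pos; rewrite ?oppr_gt0.
have sym p' q' : isosceles p' q' -> isosceles q' p'.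
  by rewrite /isosceles addrC distrC.
by move=> iso; apply/sc/sym/sc/sym.
Qed.

End Gap.

(** * The norm on planes *)

Section Planes.
Hypothesis homogeneous : forall p q (a b : R), isosceles p q ->
  isosceles (a *: p) (b *: q).

Lemma isosceles_sum_diff u v : `|u| = `|v| -> isosceles (u + v) (u - v).
Proof.
move=> eq_uv; rewrite /isosceles addrACA subrr addr0 opprB.
rewrite [v - u]addrC addrACA subrr add0r.
by rewrite -!mulr2n -(scaler_nat 2 u) -(scaler_nat 2 v) !normrZ eq_uv.
Qed.

(** Let N (a, b) be the norm of a p + b q.  It is invariant under the coordinate
    reflections, and under the exchange of a and b because p + q and p - q are
    isosceles orthogonal.  Therefore w = (A, B) and w' = (- B, A) are isosceles
    orthogonal for all A and B, and homogeneity makes N invariant under the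
    Euclidean reflection across the line of (A, B).  The reflection with
    (A, B) = (a + rho, b) exchanges (a, b) and (rho, 0), the bisector of two
    vectors of equal Euclidean length being their sum. *)
Lemma norm_orthonormal p q (a b : R) : `|p| = 1 -> `|q| = 1 -> isosceles p q ->
  `|a *: p + b *: q| = Num.sqrt (a ^+ 2 + b ^+ 2).
Proof.
move=> p1 q1 iso; pose N (s t : R) := `|s *: p + t *: q|.
have NnegR s t : N s (- t) = N s t.
  by rewrite /N scaleNr; apply/esym/homogeneous.
have NnegL s t : N (- s) t = N s t.
  by rewrite -NnegR /N !scaleNr -opprD normrN.
have Nswap s t : N s t = N t s.
  have := homogeneous ((s + t) / 2) ((s - t) / 2)
    (isosceles_sum_diff (etrans p1 (esym q1))).
  rewrite lincomb_add lincomb_sub /isosceles !lincombZ lincombD lincombB.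
  have -> : (s + t) / 2 * 1 + (s - t) / 2 * 1 = s by field.
  have -> : (s + t) / 2 * 1 + (s - t) / 2 * -1 = t by field.
  have -> : (s + t) / 2 * 1 - (s - t) / 2 * 1 = t by field.
  by have -> : (s + t) / 2 * 1 - (s - t) / 2 * -1 = s by field.
set rho := Num.sqrt _.
have rho_ge0 : 0 <= rho := sqrtr_ge0 _.
have rho2 : rho ^+ 2 = a ^+ 2 + b ^+ 2 by rewrite sqr_sqrtr// addr_ge0 ?sqr_ge0.
(* Replacing a by its absolute value ensures a + rho != 0 outside the origin. *)
have -> : `|a *: p + b *: q| = N `|a| b.
  by rewrite -/(N a b); have [//|_] := ger0P a; rewrite NnegL.
have {rho2} : rho ^+ 2 = `|a| ^+ 2 + b ^+ 2 by rewrite real_normK ?num_real.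
have : 0 <= `|a| by [].
move: `|a| rho rho_ge0 => {}a r r_ge0 a_ge0 r2.
have [ar0|ar_neq0] := eqVneq (a + r) 0.
  have a0 : a = 0 by lra.
  have r0 : r = 0 by lra.
  have b0 : b = 0.
    by apply/eqP; rewrite -sqrf_eq0; apply/eqP; move: r2; rewrite a0 r0; lra.
  by rewrite /N a0 b0 r0 !scale0r addr0 normr0.
pose w := (a + r) *: p + b *: q; pose w' := (- b) *: p + (a + r) *: q.
have iso_w : isosceles w w'.
  rewrite /isosceles /w /w' lincombD lincombB opprK.
  rewrite -/(N (a + r - b) (b + (a + r))) -/(N (a + r + b) (b - (a + r))).
  by rewrite Nswap -NnegR opprB [b + _]addrC.
have b2 : b ^+ 2 = (r + a) * (r - a).
  by rewrite mulrC -subr_sqr r2 addrAC subrr add0r.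
(* The coefficients that decompose (a, b) on w and w'. *)
have := homogeneous 2^-1 (b / (a + r) / 2) iso_w.
rewrite /isosceles /w /w' !lincombZ lincombD lincombB.
have -> : 2^-1 * (a + r) + b / (a + r) / 2 * - b = a.
  have -> : 2^-1 * (a + r) + b / (a + r) / 2 * - b =
    2^-1 * (a + r) - b ^+ 2 / (a + r) / 2 by ring.
  by rewrite b2; field.
have -> : 2^-1 * b + b / (a + r) / 2 * (a + r) = b by field.
have -> : 2^-1 * (a + r) - b / (a + r) / 2 * - b = r.
  have -> : 2^-1 * (a + r) - b / (a + r) / 2 * - b =
    2^-1 * (a + r) + b ^+ 2 / (a + r) / 2 by ring.
  by rewrite b2; field.
have -> : 2^-1 * b - b / (a + r) / 2 * (a + r) = 0 by field.
by rewrite /N => ->; rewrite scale0r addr0 normrZ p1 mulr1 ger0_norm.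
Qed.

Definition quadratic_on x y := exists A B C : R, forall s t : R,
  `|s *: x + t *: y| ^+ 2 = A * s ^+ 2 + B * (s * t) + C * t ^+ 2.

Lemma collinear_quadratic x (a b : R) : quadratic_on (a *: x) (b *: x).
Proof.
exists (a ^+ 2 * `|x| ^+ 2), (2 * a * b * `|x| ^+ 2), (b ^+ 2 * `|x| ^+ 2).
move=> s t; rewrite !scalerA -scalerDl normrZ exprMn real_normK ?num_real//.
by ring.
Qed.

(** On the orthonormal basis p, q given by the bisectors u + v and u - v, the
    vectors x and y have coordinates proportional to (k, l) and (k, - l), where
    k and l are the norms of u + v and u - v. *)
Lemma plane_quadratic x y : quadratic_on x y.
Proof.
have [->|x_neq0] := eqVneq x 0.
  by have := collinear_quadratic y 0 1; rewrite scale0r scale1r.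
have [->|y_neq0] := eqVneq y 0.
  by have := collinear_quadratic x 1 0; rewrite scale0r scale1r.
have a_neq0 : `|x| != 0 by rewrite normr_eq0.
have b_neq0 : `|y| != 0 by rewrite normr_eq0.
pose u := `|x|^-1 *: x; pose v := `|y|^-1 *: y.
have xE : x = `|x| *: u by rewrite scalerA mulfV// scale1r.
have yE : y = `|y| *: v by rewrite scalerA mulfV// scale1r.
have [uv0|k_neq0] := eqVneq (u + v) 0.
  have -> : y = (- `|y|) *: u.
    have -> : u = - v by apply/eqP; rewrite -addr_eq0 uv0.
    by rewrite scalerN scaleNr opprK -yE.
  by rewrite xE; exact: collinear_quadratic.
have [/subr0_eq uv|l_neq0] := eqVneq (u - v) 0.
  by rewrite yE xE -uv; exact: collinear_quadratic.
have nu : `|u| = 1 by rewrite normrZ normfV normr_id mulVf.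
have nv : `|v| = 1 by rewrite normrZ normfV normr_id mulVf.
pose k := `|u + v|; pose l := `|u - v|.
have {}k_neq0 : k != 0 by rewrite normr_eq0.
have {}l_neq0 : l != 0 by rewrite normr_eq0.
pose p := k^-1 *: (u + v); pose q := l^-1 *: (u - v).
have np : `|p| = 1 by rewrite normrZ normfV normr_id mulVf.
have nq : `|q| = 1 by rewrite normrZ normfV normr_id mulVf.
have iso_pq : isosceles p q.
  by apply/homogeneous/isosceles_sum_diff; rewrite nu nv.
have uE : u = (k / 2) *: p + (l / 2) *: q.
  rewrite /p /q !scalerA !(mulrAC _ 2^-1) !mulfV// !mul1r -scalerDr.
  rewrite addrACA subrr addr0 -mulr2n -(scaler_nat 2 u) scalerA.
  by rewrite mulVf ?scale1r.
have vE : v = (k / 2) *: p + (- (l / 2)) *: q.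
  rewrite scaleNr /p /q !scalerA !(mulrAC _ 2^-1) !mulfV// !mul1r -scalerBr.
  rewrite opprB [v - u]addrC addrACA subrr add0r -mulr2n.
  by rewrite -(scaler_nat 2 v) scalerA mulVf ?scale1r.
pose a := `|x|; pose b := `|y|.
exists (a ^+ 2 * (k ^+ 2 + l ^+ 2) / 4), (a * b * (k ^+ 2 - l ^+ 2) / 2),
  (b ^+ 2 * (k ^+ 2 + l ^+ 2) / 4) => s t.
rewrite xE yE -/a -/b uE vE !lincombZ lincombD norm_orthonormal//.
by rewrite sqr_sqrtr ?addr_ge0 ?sqr_ge0//; field.
Qed.

End Planes.

(** * The inner product *)

Section JordanVonNeumann.
Hypothesis quadratic : forall x y, quadratic_on x y.

Definition polar x y : R := (`|x + y| ^+ 2 - `|x - y| ^+ 2) / 4.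

Lemma parallelogram x y :
  `|x + y| ^+ 2 + `|x - y| ^+ 2 = 2 * (`|x| ^+ 2 + `|y| ^+ 2).
Proof.
have [A [B [C E]]] := quadratic x y.
have := E 1 1; have := E 1 (- 1); have := E 1 0; have := E 0 1.
rewrite !scale1r !scale0r scaleN1r addr0 add0r => -> -> -> ->; ring.
Qed.

Lemma polarC x y : polar x y = polar y x.
Proof. by rewrite /polar (addrC x) (distrC x). Qed.

(** The square terms of the polynomial cancel in polar (k x) y, which is
    B k / 2; no passage from rational to real k is needed. *)
Lemma polarZl (k : R) x y : polar (k *: x) y = k * polar x y.
Proof.
have [A [B [C E]]] := quadratic x y; rewrite /polar.
have := E 1 1; have := E 1 (- 1); have := E k 1; have := E k (- 1).
rewrite !scale1r !scaleN1r => -> -> -> ->; ring.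
Qed.

(** Four instances of the parallelogram law: those for (x + y, z) and (z + y, x)
    contain |x + z + y|, those for (x - y, z) and (z - y, x) contain
    |x + z - y|, and the norms of x + y - z and z + y - x occur once in each
    pair, so they cancel. *)
Lemma polarDl x z y : polar (x + z) y = polar x y + polar z y.
Proof.
have := parallelogram (x + y) z; have := parallelogram (x - y) z.
have := parallelogram (z + y) x; have := parallelogram (z - y) x.
rewrite /polar.
have -> : z - y + x = x + z - y by rewrite addrAC (addrC z).
have -> : z + y + x = x + z + y by rewrite addrAC (addrC z).
have -> : x + y + z = x + z + y by rewrite addrAC.
have -> : x - y + z = x + z - y by rewrite addrAC.
have -> : `|z - y - x| = `|x + y - z| by rewrite -normrN !opprB addrA.
have -> : `|x - y - z| = `|z + y - x| by rewrite -normrN !opprB addrA.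
lra.
Qed.

Lemma polarE x : polar x x = `|x| ^+ 2.
Proof.
rewrite /polar subrr normr0 -mulr2n -(scaler_nat 2 x) normrZ normr_nat. lra.
Qed.

Lemma polar_linear y : GRing.linear_for *%R (polar^~ y).
Proof. by move=> k x z; rewrite polarDl polarZl. Qed.

Lemma jordan_von_neumann : inner_product_space X.
Proof.
have bil : bilinear_for *%R (idfun \; *%R) polar.
  split=> u k x z /=; first exact: polar_linear.
  by rewrite !(polarC u) polar_linear.
have herm x y : polar x y = (-1) ^+ false * idfun (polar y x).
  by rewrite expr0 mul1r polarC.
have pos x : x != 0 -> 0 < polar x x.
  by move=> x_neq0; rewrite polarE exprn_gt0// normr_gt0.
pose bilM := bilinear_isBilinear.Build R X X R *%R (idfun \; *%R) polar bil.
pose hermM := isHermitianSesquilinear.Build R X false idfun polar herm.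
pose dotM := isDotProduct.Build R X polar pos.
pose dot : {dot X for idfun} := HB.pack polar bilM hermM dotM.
by exists dot => x; rewrite /= polarE sqrtr_sqr normr_id.
Qed.

End JordanVonNeumann.
End Orthogonality.

Theorem corollary6 (R : realType) (X : normedModType R) (r : R)
    (r_gt0 : 0 < r) (r_le1 : r <= 1) :
  inner_product_space X <->
  (forall x y : X, x != 0 -> y != 0 -> x != y ->
     angular_distance x y <=
       ((1 + cfactor x y `^ r) / 2) `^ r^-1 *
       ((`|x - y| + `| `|x| - `|y| |) / Num.max `|x| `|y|)).
Proof.
split=> [innerX x y x_neq0 y_neq0 neq_xy|bound].
  have c_ge0 := cfactor_ge0 x y.
  set k := _ / Num.max _ _.
  have k_ge0 : 0 <= k by rewrite divr_ge0// ?addr_ge0// le_max normr_ge0.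
  apply: (@le_trans _ _ (Num.sqrt (cfactor x y) * k)); last first.
    by rewrite ler_wpM2r// geometric_le_power_mean.
  rewrite -ler_sqr ?nnegrE ?mulr_ge0 ?sqrtr_ge0 ?normr_ge0//.
  by rewrite exprMn sqr_sqrtr// geometric_bound// angular_distance_inner.
apply: jordan_von_neumann; apply: plane_quadratic.
apply: isosceles_homogeneous; apply: angular_bound_gap => x y x0 y0 neq_xy.
rewrite -arithmetic_bound//; apply: le_trans (bound x y x0 y0 neq_xy) _.
by rewrite ler_wpM2r ?power_mean_le_arithmetic ?cfactor_ge0.
Qed.
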